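(* Every pattern-free graph class is monadically dependent.
   Context: Graphs are finite, simple and undirected; graph classes are considered up to isomorphism. Write $[n]=\{1,\dots,n\}$. A graph class ''contains $H$ as an induced subgraph'' if some graph in the class has an induced subgraph isomorphic to $H$. Patterns. For $m,r\in\mathbb{N}$, an $(m,r)$-pattern is a graph $G$ with vertex set $[m]\times[r]$ such that, writing $L_j(G)=\{(i,j):i\in[m]\}$ for the $j$th layer ($j\in[r]$): (1) each layer induces a clique or an independent set; (2) for every two distinct layers $L_j(G),L_{j'}(G)$: if $|j-j'|>1$ they are either fully adjacent or fully non-adjacent, and if $|j-j'|=1$ there is a relation ${\sim}\in\{=,\neq,\le,\ge,<,>\}$ such that for all $i,i'\in[m]$, $(i,j)(i',j')\in E(G)\Leftrightarrow i\sim i'$. A graph is $(m,r)$-pattern-free if it contains no $(m,r)$-pattern as an induced subgraph. A graph class is pattern-free if there are $m,r\in\mathbb{N}$ such that every graph in the class is $(m,r)$-pattern-free. Flips. Let $G$ be a graph, $\mathcal{K}$ a partition of $V(G)$, $\mathcal{K}(v)$ the part containing $v$, and $F\subseteq\mathcal{K}^2$ symmetric. The graph $G\oplus F$ has vertex set $V(G)$ and, for distinct $u,v$: if $(\mathcal{K}(u),\mathcal{K}(v))\in F$ then $uv\in E(G\oplus F)\Leftrightarrow uv\notin E(G)$; otherwise $uv\in E(G\oplus F)\Leftrightarrow uv\in E(G)$. A $k$-flip of $G$ is a graph $G\oplus F$ obtained in this way with $\mathcal{K}$ having at most $k$ parts. Crossings and comparability grids. For $r\ge1$, the star $r$-crossing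 of order $n$ is the $r$-subdivision of $K_{n,n}$: it has roots $a_1,\dots,a_n$, $b_1,\dots,b_n$ and pairwise vertex-disjoint $r$-vertex paths $\pi_{i,j}$ ($i,j\in[n]$) not containing roots, with $\pi(i,j,t)$ denoting the $t$th vertex of $\pi_{i,j}$; each $a_i$ is adjacent to $\{\pi(i,j,1):j\in[n]\}$ and each $b_j$ is adjacent to $\{\pi(i,j,r):i\in[n]\}$. The clique $r$-crossing of order $n$ is obtained from the star $r$-crossing of order $n$ by turning the neighborhood of each root into a clique. The half-graph $r$-crossing of order $n$ is defined like the star $r$-crossing, except that each root $a_i$ is instead adjacent to $\{\pi(i',j,1):i',j\in[n],\,i\le i'\}$ and each root $b_j$ is instead adjacent to $\{\pi(i,j',r):i,j'\in[n],\,j\le j'\}$. There are no edges other than those described. The comparability grid of order $n$ has vertices $a_{i,j}$ ($i,j\in[n]$), with distinct $a_{i,j},a_{i',j'}$ adjacent if and only if $i=i'$, or $j=j'$, or ($i<i'\Leftrightarrow j<j'$). Monadic dependence. A graph class $\mathscr{C}$ is monadically independent if there are $r\ge1$ and $k\in\mathbb{N}$ such that at least one of the following holds: for every $n$, $\mathscr{C}$ contains a $k$-flip of the star $r$-crossing of order $n$ as an induced subgraph; for every $n$, $\mathscr{C}$ contains a $k$-flip of the clique $r$-crossing of order $n$ as an induced subgraph; for every $n$, $\mathscr{C}$ contains a $k$-flip of the half-graph $r$-crossing of order $n$ as an induced subgraph; for every $n$, $\mathscr{C}$ contains the comparability grid of order $n$ as an induced subgraph. Otherwise $\mathscr{C}$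 is monadically dependent. (This is known to be equivalent to the model-theoretic definition via first-order transductions.) *)

(* Defs.v *)
From HB Require Import structures.
From mathcomp Require Import all_boot.

Set Implicit Arguments.
Unset Strict Implicit.
Unset Printing Implicit Defensive.

Record sgraph (V : finType) := SGraph {
  adj :> rel V;
  adj_sym : symmetric adj;
  adj_irr : irreflexive adj }.

(* The simple graph in which distinct u, v are adjacent iff e u v or e v u:
   [e] lists each edge in at least one direction. *)
Section GraphOf.
Variables (V : finType) (e : rel V).
Definition graph_of_adj : rel V := fun u v => (u != v) && (e u v || e v u).
Lemma graph_of_sym : symmetric graph_of_adj.
Proof. by move=> u v; rewrite /graph_of_adj eq_sym orbC. Qed.
Lemma graph_of_irr : irreflexive graph_of_adj.
Proof. by move=> u; rewrite /graph_of_adj eqxx. Qed.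
Definition graph_of : sgraph V := SGraph graph_of_sym graph_of_irr.
End GraphOf.

(* H is isomorphic to an induced subgraph of G. *)
Definition induced_in (W V : finType) (H : sgraph W) (G : sgraph V) : Prop :=
  exists2 f : W -> V, injective f & forall u v, G (f u) (f v) = H u v.

(* Closure under isomorphism is not required: every notion below depends on a
   class only through the isomorphism types of its members. *)
Definition graph_class := forall V : finType, sgraph V -> Prop.

Definition contains (C : graph_class) (W : finType) (H : sgraph W) : Prop :=
  exists (V : finType) (G : sgraph V), C V G /\ induced_in H G.

(** * Patterns *)

Inductive layer_cmp := CmpEq | CmpNeq | CmpLe | CmpGe | CmpLt | CmpGt.

Definition compare_by (c : layer_cmp) : rel nat :=
  match c with
  | CmpEq => fun i i' => i == i'
  | CmpNeq => fun i i' => i != i'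
  | CmpLe => fun i i' => i <= i'
  | CmpGe => fun i i' => i >= i'
  | CmpLt => fun i i' => i < i'
  | CmpGt => fun i i' => i > i'
  end.

(* Indices are 0-based; the jth layer is the set of the (i, j), i : 'I_m. *)
Section Patterns.
Variables (m r : nat) (P : sgraph ('I_m * 'I_r)%type).

Definition layer_homogeneous (j : 'I_r) : Prop :=
  (forall i i' : 'I_m, i != i' -> P (i, j) (i', j))
  \/ (forall i i' : 'I_m, ~~ P (i, j) (i', j)).

Definition layers_homogeneous (j j' : 'I_r) : Prop :=
  (forall i i' : 'I_m, P (i, j) (i', j'))
  \/ (forall i i' : 'I_m, ~~ P (i, j) (i', j')).

Definition layers_compared (j j' : 'I_r) : Prop :=
  exists c : layer_cmp,
    forall i i' : 'I_m, P (i, j) (i', j') = compare_by c i i'.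

Definition consecutive (j j' : 'I_r) : bool :=
  (j.+1 == j' :> nat) || (j'.+1 == j :> nat).

Definition is_pattern : Prop :=
  (forall j, layer_homogeneous j)
  /\ (forall j j', j != j' ->
        if consecutive j j' then layers_compared j j'
        else layers_homogeneous j j').

End Patterns.

Definition graph_pattern_free (m r : nat) (V : finType) (G : sgraph V) : Prop :=
  forall P : sgraph ('I_m * 'I_r)%type, is_pattern P -> ~ induced_in P G.

Definition pattern_free (C : graph_class) : Prop :=
  exists m r : nat,
    forall (V : finType) (G : sgraph V), C V G -> graph_pattern_free m r G.

(** * Flips *)

Definition is_flip (V : finType) (G : sgraph V) (K : {set {set V}})
    (F : {set {set V} * {set V}}) (H : sgraph V) : Prop :=
  forall u v, u != v ->
    H u v = if (pblock K u, pblock K v) \in F then ~~ G u v else G u v.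

Definition is_kflip (k : nat) (V : finType) (G H : sgraph V) : Prop :=
  exists (K : {set {set V}}) (F : {set {set V} * {set V}}),
    [/\ partition K [set: V] /\ #|K| <= k,
        F \subset setX K K,
        (forall A B, ((A, B) \in F) = ((B, A) \in F))
      & is_flip G K F H].

Definition contains_kflip (k : nat) (C : graph_class) (W : finType)
    (G : sgraph W) : Prop :=
  exists H : sgraph W, is_kflip k G H /\ contains C H.

(** * Crossings and comparability grids *)

(* inl (inl i) is the root a_i, inl (inr j) the root b_j, and inr (i, j, t) the
   vertex of pi_{i,j} at (0-based) position t. *)
Definition crossing_vertex (n r : nat) : finType :=
  (('I_n + 'I_n) + ('I_n * 'I_n * 'I_r))%type.

Section Crossings.
Variables n r : nat.

(* In all three crossings, a root sees only first (for a_i) or last (for b_j)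
   vertices of paths; [ra i i'] says whether a_i sees the first vertices of the
   paths from a_i', and [rb j j'] whether b_j sees the last vertices of the
   paths to b_j'. *)
Definition crossing_arc (ra rb : rel 'I_n) (u v : crossing_vertex n r) : bool :=
  match u, v with
  | inl (inl i), inr (i', _, t) => ra i i' && (t == 0 :> nat)
  | inl (inr j), inr (_, j', t) => rb j j' && (t.+1 == r :> nat)
  | inr (i, j, t), inr (i', j', t') =>
      [&& i == i', j == j' & t.+1 == t' :> nat]
  | _, _ => false
  end.

Definition star_crossing : sgraph (crossing_vertex n r) :=
  graph_of (crossing_arc eq_op eq_op).

Definition clique_crossing : sgraph (crossing_vertex n r) :=
  graph_of (fun u v => star_crossing u v
    || [exists x : 'I_n + 'I_n,
          star_crossing (inl x) u && star_crossing (inl x) v]).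

Definition half_graph_crossing : sgraph (crossing_vertex n r) :=
  graph_of (crossing_arc (fun i i' : 'I_n => i <= i') (fun j j' : 'I_n => j <= j')).

End Crossings.

Definition comparability_grid (n : nat) : sgraph ('I_n * 'I_n)%type :=
  graph_of (fun u v : 'I_n * 'I_n => [|| u.1 == v.1, u.2 == v.2
                         | (u.1 < v.1) == (u.2 < v.2)]).

(** * Monadic dependence *)

Definition monadically_independent (C : graph_class) : Prop :=
  exists r k : nat, 1 <= r /\
    [\/ forall n, contains_kflip k C (star_crossing n r),
        forall n, contains_kflip k C (clique_crossing n r),
        forall n, contains_kflip k C (half_graph_crossing n r)
      | forall n, contains C (comparability_grid n)].

Definition monadically_dependent (C : graph_class) : Prop :=
  ~ monadically_independent C.

(* Main.v *)
(* Each of the four obstructions contains arbitrarily large patterns.  By a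
   bipartite Ramsey argument, a large flipped crossing contains a sub-crossing in
   which the flip class of a vertex depends only on its role (the side of a root,
   the position on a path).  Flipping then only complements relations between
   layers, so the flip can be ignored.  With indices grouped into consecutive
   blocks I_0 < I_1 < ... of size m, the m parallel walks
     a_{I_0}, pi(I_0, I_0, .), b_{I_0}, pi(I_1, I_0, .) backwards, a_{I_1}, ...
   form a pattern whose relations are = in the star crossing, and = or an order
   in the half-graph crossing: roots see vertices of other blocks all at once or
   not at all.  In the clique crossing, the same walks without the roots work.
   In the comparability grid, take the staircase of diagonals of the blocks
   I_0 x I_0, I_0 x I_1, I_1 x I_1, I_1 x I_2, ... *)

From mathcomp Require Import all_boot zify.
Require Import Defs.

Set Implicit Arguments.
Unset Strict Implicit.
Unset Printing Implicit Defensive.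

(** * Patterns and flips *)

Definition converse_cmp (c : layer_cmp) : layer_cmp :=
  match c with
  | CmpEq => CmpEq | CmpNeq => CmpNeq
  | CmpLe => CmpGe | CmpGe => CmpLe
  | CmpLt => CmpGt | CmpGt => CmpLt
  end.

Lemma compare_by_converse c i i' :
  compare_by (converse_cmp c) i i' = compare_by c i' i.
Proof. by case: c => //=; rewrite eq_sym. Qed.

Definition negate_cmp (c : layer_cmp) : layer_cmp :=
  match c with
  | CmpEq => CmpNeq | CmpNeq => CmpEq
  | CmpLe => CmpGt | CmpGt => CmpLe
  | CmpGe => CmpLt | CmpLt => CmpGe
  end.

Lemma compare_by_negate c i i' :
  compare_by (negate_cmp c) i i' = ~~ compare_by c i i'.
Proof. by case: c => //=; rewrite ?negbK -?ltnNge -?leqNgt. Qed.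

Section Pullback.
Variables (U V : finType) (f : U -> V) (G : sgraph V).

(** For injective [f], a relabelled induced subgraph of [G]; patterns are exhibited as such
    pullbacks. *)
Definition pullback_adj : rel U := fun x y => G (f x) (f y).
Lemma pullback_sym : symmetric pullback_adj.
Proof. by move=> x y; apply: adj_sym. Qed.
Lemma pullback_irr : irreflexive pullback_adj.
Proof. by move=> x; apply: adj_irr. Qed.
Definition pullback : sgraph U := SGraph pullback_sym pullback_irr.

End Pullback.

Lemma layers_comparedC m r (P : sgraph ('I_m * 'I_r)%type) j j' :
  layers_compared P j j' -> layers_compared P j' j.
Proof.
case=> c Hc; exists (converse_cmp c) => i i'.
by rewrite adj_sym Hc compare_by_converse.
Qed.

Lemma layers_homogeneousC m r (P : sgraph ('I_m * 'I_r)%type) j j' :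
  layers_homogeneous P j j' -> layers_homogeneous P j' j.
Proof. by case=> H; [left | right] => i i'; rewrite adj_sym; apply: H. Qed.

(** Enough by symmetry, since the six relations are closed under taking converses. *)
Lemma is_pattern_ltn m r (P : sgraph ('I_m * 'I_r)%type) :
  (forall j, layer_homogeneous P j) ->
  (forall j j' : 'I_r, j.+1 = j' :> nat -> layers_compared P j j') ->
  (forall j j' : 'I_r, j.+1 < j' -> layers_homogeneous P j j') ->
  is_pattern P.
Proof.
move=> Hl Hc Hh; split=> // j j' neq; have {}neq : j != j' :> nat by [].
rewrite /consecutive; case: eqP => [/Hc//|H1] /=.
case: eqP => [/Hc/layers_comparedC//|H2].
have [/Hh//|/Hh/layers_homogeneousC//] : j.+1 < j' \/ j'.+1 < j by lia.
Qed.

(** Turns the partition into a colouring whose palette depends on [k] only, so that Ramsey arguments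
    apply. The extra colour keeps the palette inhabited when [k] is 0. *)
Lemma kflip_coloring k (W : finType) (G H : sgraph W) : is_kflip k G H ->
  exists (c : W -> 'I_k.+1) (B : rel 'I_k.+1),
    forall u v, u != v -> H u v = B (c u) (c v) (+) G u v.
Proof.
case=> K [F [[parK leKk] _ _ flipH]].
have inK u : pblock K u \in K.
  by apply: pblock_mem; rewrite (cover_partition parK) inE.
pose part (a : 'I_k.+1) := nth set0 (enum K) a.
pose c u : 'I_k.+1 := inord (index (pblock K u) (enum K)).
have partc u : part (c u) = pblock K u.
  rewrite /part inordK ?nth_index ?mem_enum//.
  by rewrite ltnS (leq_trans _ leKk)// cardE index_size.
exists c, (fun a b => (part a, part b) \in F) => u v neq.
by rewrite flipH// !partc; case: (_ \in F).
Qed.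

(** With monochromatic layers, the flip keeps or complements all edges between two given layers at
    once, and the pattern conditions are closed under complement. *)
Lemma is_pattern_flip m r k (W : finType) (G H : sgraph W)
    (c : W -> 'I_k) (B : rel 'I_k) (f : 'I_m * 'I_r -> W) :
  (forall u v, u != v -> H u v = B (c u) (c v) (+) G u v) ->
  injective f -> (forall i i' j, c (f (i, j)) = c (f (i', j))) ->
  is_pattern (pullback f G) -> is_pattern (pullback f H).
Proof.
move=> flipH injf cf [Gl Gll].
have flipP x y : x != y ->
    pullback f H x y = B (c (f x)) (c (f y)) (+) pullback f G x y.
  by move=> neq; apply: flipH; rewrite (inj_eq injf).
split=> [j|j j' neq].
(* Row [i0] supplies the colour of each layer; without rows the condition is vacuous. *)
- have [i0 _|no] := pickP 'I_m; last by left=> i; have := no i.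
  have flipj i i' : i != i' -> pullback f H (i, j) (i', j) =
      B (c (f (i0, j))) (c (f (i0, j))) (+) pullback f G (i, j) (i', j).
    by move=> nii; rewrite flipP ?(cf i i0) ?(cf i' i0)// xpair_eqE eqxx andbT.
  case: (boolP (B (c (f (i0, j))) (c (f (i0, j))))) flipj => _ flipj;
    case: (Gl j) => {}Gl.
  + right=> i i'; have [->|nii] := eqVneq i i'; first by rewrite adj_irr.
    by rewrite flipj// Gl.
  + by left=> i i' nii; rewrite flipj// (negbTE (Gl _ _)).
  + by left=> i i' nii; rewrite flipj// Gl.
  + right=> i i'; have [->|nii] := eqVneq i i'; first by rewrite adj_irr.
    by rewrite flipj// (negbTE (Gl _ _)).
- have [i0 _|no] := pickP 'I_m; last first.
    case: ifP => _; last by left=> i; have := no i.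
    by exists CmpEq => x; have := no x.
  have flipj i i' : pullback f H (i, j) (i', j') =
      B (c (f (i0, j))) (c (f (i0, j'))) (+) pullback f G (i, j) (i', j').
    by rewrite flipP ?(cf i i0) ?(cf i' i0)// xpair_eqE (negbTE neq) andbF.
  case: (B _ _) flipj => flipj; case: ifP (Gll j j' neq) => _.
  + case=> d Hd; exists (negate_cmp d) => i i'.
    by rewrite flipj Hd compare_by_negate.
  + by case=> Hd; [right | left] => i i'; rewrite flipj ?Hd ?(negbTE (Hd _ _)).
  + by case=> d Hd; exists d => i i'; rewrite flipj Hd.
  + by case=> Hd; [left | right] => i i'; rewrite flipj ?Hd ?(negbTE (Hd _ _)).
Qed.

Lemma pattern_free_embedding (C : graph_class) m r (W : finType) (H : sgraph W)
    (f : 'I_m * 'I_r -> W) :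
  (forall (V : finType) (G : sgraph V), C V G -> graph_pattern_free m r G) ->
  contains C H -> injective f -> is_pattern (pullback f H) -> False.
Proof.
move=> free [V [G [CG [h injh hH]]]] injf patP; apply: (free V G CG _ patP).
by exists (h \o f) => [|x y]; [apply: inj_comp | rewrite /= hH].
Qed.

(** * Ramsey for crossings *)

(** [f] lists the first [N] elements of a large colour class in increasing order. *)
Lemma pigeonhole_increasing (D : finType) N n (c : 'I_n -> D) :
  0 < n -> #|D| * N <= n ->
  exists (a : D) (f : 'I_N -> 'I_n),
    (forall i j : 'I_N, (f i < f j) = (i < j)) /\ forall i, c (f i) = a.
Proof.
move=> n_gt0 le_n.
have [a leNa] : exists a, N <= #|[pred x | c x == a]|.
  apply/existsP; apply: contraLR le_n => /existsPn small.
  rewrite -ltnNge -[X in X < _]card_ord -sum1_card (partition_big c predT)//=.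
  have D_gt0 : 0 < #|D| by apply/card_gt0P; exists (c (Ordinal n_gt0)).
  apply: (@leq_ltn_trans (\sum_(a : D) N.-1)).
    apply: leq_sum => a _; rewrite sum1_card.
    by have := small a; rewrite -ltnNge; case: (N) => // N'; rewrite ltnS.
  rewrite sum_nat_const ltn_mul2l D_gt0 /=.
  by have := small (c (Ordinal n_gt0)); case: (N).
pose s := [seq val x | x <- enum [pred x | c x == a]].
have sz : size s = #|[pred x | c x == a]| by rewrite size_map -cardE.
have srt : sorted ltn s.
  rewrite /s /enum_mem; apply: (subseq_sorted ltn_trans).
    by apply: map_subseq (filter_subseq _ _).
  by rewrite -enumT val_enum_ord iota_ltn_sorted.
pose f (i : 'I_N) := enum_val (widen_ord leNa i).
have valf i : f i = nth 0 s i :> nat.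
  rewrite /s (nth_map (Ordinal n_gt0)) -?cardE ?(leq_trans (ltn_ord i))//.
  by rewrite /f (enum_val_nth (Ordinal n_gt0)).
exists a, f; split=> [i j|i]; last first.
  by have := enum_valP (widen_ord leNa i); rewrite inE => /eqP.
have lt_sz (x : 'I_N) : x < size s by rewrite sz (leq_trans (ltn_ord x)).
have H x y : x < y -> y < size s -> nth 0 s x < nth 0 s y.
  move=> xy ys; apply: (sorted_ltn_nth ltn_trans) => //.
  by rewrite inE (ltn_trans xy).
rewrite !valf.
case: (ltngtP i j) => [ij|ji|->]; rewrite ?ltnn//; first by rewrite H.
by apply/negbTE; rewrite -leqNgt ltnW ?H.
Qed.

(** Two rounds of pigeonhole: first inside each row, restricted to [n2] columns, then among the
    rows. As [n2] is fixed beforehand, the number of possible outcomes of the first round is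
    bounded, and rows with the same outcome share one selection [g] of columns. *)
Lemma bipartite_ramsey (D A B : finType) N :
  exists n, forall (c : 'I_n -> 'I_n -> D) (ca : 'I_n -> A) (cb : 'I_n -> B),
  exists (f g : 'I_N.+1 -> 'I_n),
  [/\ forall i j : 'I_N.+1, (f i < f j) = (i < j),
      forall i j : 'I_N.+1, (g i < g j) = (i < j),
      forall i i' j j', c (f i) (g j) = c (f i') (g j'),
      forall i i', ca (f i) = ca (f i') & forall i i', cb (g i) = cb (g i')].
Proof.
pose n2 := (#|{: D * B}| * N.+1).+1.
(* The outcome for a row: the colour of the row itself, the common colours found in it, and the
   selected columns. *)
pose E := (A * (D * B) * {ffun 'I_N.+1 -> 'I_n2})%type.
pose n := n2 + #|{: E}| * N.+1.
exists n => c ca cb; have le2 : n2 <= n by apply: leq_addr.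
have row i : exists p : (D * B) * {ffun 'I_N.+1 -> 'I_n2},
    (forall j j' : 'I_N.+1, (p.2 j < p.2 j') = (j < j')) /\
    forall j, (c i (widen_ord le2 (p.2 j)), cb (widen_ord le2 (p.2 j))) = p.1.
  have [a [g [incr const]]] := @pigeonhole_increasing _ N.+1 n2
    (fun j => (c i (widen_ord le2 j), cb (widen_ord le2 j))) isT (leqnSn _).
  by exists (a, [ffun j => g j]); split=> [j j'|j]; rewrite !ffunE.
have {row} [h hP] := fin_all_exists row.
have [[[a d] g] [f [fincr fconst]]] := @pigeonhole_increasing _ N.+1 n
  (fun i => (ca i, (h i).1, (h i).2)) isT (leq_addl _ _).
have i0 : 'I_N.+1 := ord0.
have hf i : (h (f i)).1 = d /\ (h (f i)).2 = g by case: (fconst i).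
exists f, (fun j => widen_ord le2 (g j)); split=> //.
- by move=> i j /=; have [_ <-] := hf i0; have [-> _] := hP (f i0).
- move=> i i' j j'.
  have [_ /(_ j)] := hP (f i); have [_ /(_ j')] := hP (f i').
  by case: (hf i) (hf i') => -> -> [-> ->] <- [].
- by move=> i i'; have [-> _ _] := fconst i; have [-> _ _] := fconst i'.
- move=> i i'; have [_ H] := hP (f i0); have := H i; have := H i'.
  by case: (hf i0) => -> -> <- [].
Qed.

(* [f p i] is the ith element of the pth block of indices; only the blocks up to
   [R] are meaningful. *)
Definition block_increasing m R n (f : nat -> 'I_m -> 'I_n) : Prop :=
  forall p q i i', p <= R -> q <= R ->
    (f p i < f q i') = if p == q then i < i' else p < q.

Lemma block_increasing_leq m R n (f : nat -> 'I_m -> 'I_n) p q i i' :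
  block_increasing R f -> p <= R -> q <= R ->
  (f p i <= f q i') = if p == q then i <= i' else p < q.
Proof.
move=> incr leR leR'; rewrite leqNgt incr// eq_sym.
by case: eqP => [_|ne]; lia.
Qed.

Lemma block_increasing_eq m R n (f : nat -> 'I_m -> 'I_n) p q i i' :
  block_increasing R f -> p <= R -> q <= R ->
  (f p i == f q i') = (p == q) && (i == i').
Proof.
move=> incr leR leR'; rewrite -!val_eqE /= !eqn_leq.
by rewrite !(block_increasing_leq _ _ incr)// (eq_sym q); case: eqP => // ne; lia.
Qed.

Lemma ltn_block m p q (i i' : 'I_m) : p < q -> p * m + i < q * m + i'.
Proof.
move=> pq; apply: (@leq_trans (p.+1 * m)); first by rewrite mulSn addnC ltn_add2r.
by apply: leq_trans (leq_addr _ _); rewrite leq_mul2r pq orbT.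
Qed.

Lemma ltn_block_if m p q (i i' : 'I_m) :
  (p * m + i < q * m + i') = if p == q then i < i' else p < q.
Proof.
case: (ltngtP p q) => [pq|qp|->]; [exact: ltn_block | | exact: ltn_add2l].
by apply/negbTE; rewrite -leqNgt ltnW// ltn_block.
Qed.

Lemma leq_block_if m p q (i i' : 'I_m) :
  (p * m + i <= q * m + i') = if p == q then i <= i' else p < q.
Proof. by rewrite leqNgt ltn_block_if eq_sym; case: eqP => [_|ne]; lia. Qed.

Lemma eqn_block m p q (i i' : 'I_m) :
  (p * m + i == q * m + i') = (p == q) && (i == i').
Proof.
rewrite -(val_eqE i) eqn_leq !leq_block_if (eq_sym q) /=.
by case: (p =P q) => ne; lia.
Qed.

Lemma block_bound m R p (i : 'I_m) : p <= R -> p * m + i < (R.+1 * m).+1.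
Proof.
move=> leR; apply: leq_trans (leqnSn _); apply: (@leq_trans (p.+1 * m)).
  by rewrite mulSn addnC ltn_add2r.
by rewrite leq_mul2r ltnS leR orbT.
Qed.

(** Cuts the range into [R.+1] consecutive intervals of length [m]. Beyond block [R] the index may
    overflow, and [inord] then falls back to a default value. *)
Lemma block_increasing_of m R n (f : 'I_(R.+1 * m).+1 -> 'I_n) :
  (forall x y, (f x < f y) = (x < y)) ->
  block_increasing R (fun p (i : 'I_m) => f (inord (p * m + i))).
Proof.
move=> incr p q i i' leR leR'.
by rewrite incr !inordK ?block_bound// ltn_block_if.
Qed.

(** What makes layers monochromatic: the parallel walk number [i] uses the [i]th element of every
    block on both sides, so only paths between [i]th elements are constrained. *)
Definition uniform_coloring r k m n (c : crossing_vertex n r -> 'I_k)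
    (f g : nat -> 'I_m -> 'I_n) : Prop :=
  [/\ forall p i i', c (inl (inl (f p i))) = c (inl (inl (f p i'))),
      forall q i i', c (inl (inr (g q i))) = c (inl (inr (g q i'))) &
      forall p q i i' t, c (inr (f p i, g q i, t)) = c (inr (f p i', g q i', t))].

Lemma crossing_ramsey r k m R : exists n, forall c : crossing_vertex n r -> 'I_k,
  exists f g : nat -> 'I_m -> 'I_n,
    [/\ block_increasing R f, block_increasing R g & uniform_coloring c f g].
Proof.
have [n Hn] := bipartite_ramsey {ffun 'I_r -> 'I_k} 'I_k 'I_k (R.+1 * m).
exists n => c.
(* Each pair is coloured by the whole list of colours along its path, so one application treats all
   positions. *)
have [f [g [fi gi cfg cf cg]]] := Hn (fun i j => [ffun t => c (inr (i, j, t))])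
  (fun i => c (inl (inl i))) (fun j => c (inl (inr j))).
exists (fun p i => f (inord (p * m + i))), (fun p i => g (inord (p * m + i))).
split; do ?exact: block_increasing_of; split=> //= p q i i' t.
by have /ffunP/(_ t) := cfg (inord (p * m + i)) (inord (p * m + i'))
  (inord (q * m + i)) (inord (q * m + i')); rewrite !ffunE.
Qed.

(** [crossing_ramsey] fixes [n] before the flip is known. [R] is both the number of layers and the
    bound on block numbers, as a walk of [R] stations stays within these blocks. *)
Lemma crossing_flip_not_contained (C : graph_class) m R r k
    (G : forall n, sgraph (crossing_vertex n r)) :
  (forall (V : finType) (H : sgraph V), C V H -> graph_pattern_free m R H) ->
  (forall n (f g : nat -> 'I_m -> 'I_n),
     block_increasing R f -> block_increasing R g ->
     exists w : 'I_m * 'I_R -> crossing_vertex n r,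
       [/\ injective w, is_pattern (pullback w (G n)) &
           forall c : crossing_vertex n r -> 'I_k.+1, uniform_coloring c f g ->
             forall i i' j, c (w (i, j)) = c (w (i', j))]) ->
  ~ forall n, contains_kflip k C (G n).
Proof.
move=> free walks flips.
have [n Hn] := crossing_ramsey r k.+1 m R.
have [H [/kflip_coloring[c [B flipH]] CH]] := flips n.
have [f [g [fi gi unif]]] := Hn c.
have [w [injw patw /(_ c unif) cw]] := walks n f g fi gi.
exact: pattern_free_embedding free CH injw (is_pattern_flip flipH injw cw patw).
Qed.

(** * Star and half-graph crossings *)

(* The stations of a walk in a crossing whose paths have r.+1 vertices:
   a root of either side, or position t on a path from block p to block q. *)
Inductive station := RootA of nat | RootB of nat | OnPath of nat & nat & nat.

Section Walk.
Variable r : nat.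

(** Paths with [p == q] are traversed forwards, to [RootB q]; the others, between blocks [q.+1] and
    [q], backwards to [RootA q.+1]. *)
Definition next_station (D : station) : station :=
  match D with
  | RootA p => OnPath p p 0
  | RootB q => OnPath q.+1 q r
  | OnPath p q t =>
      if p == q then (if t < r then OnPath p q t.+1 else RootB q)
      else (if t is t'.+1 then OnPath p q t' else RootA p)
  end.

Definition on_walk (D : station) : bool :=
  if D is OnPath p q t then ((p == q) || (p == q.+1)) && (t <= r) else true.

(** Position along the walk, with period [2 * r + 4]: two roots and two paths of [r.+1] vertices. It
    is a left inverse of [walk]. *)
Definition station_index (D : station) : nat :=
  match D with
  | RootA p => p * (2 * r + 4)
  | RootB q => q * (2 * r + 4) + r.+2
  | OnPath p q t =>
      q * (2 * r + 4) + (if p == q then t.+1 else 2 * r + 3 - t)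
  end.

(** Oriented like [crossing_arc], so a path walked backwards is traversed against the links. *)
Definition linked (D E : station) : bool :=
  match D, E with
  | RootA p, OnPath p' _ t => (p == p') && (t == 0)
  | RootB q, OnPath _ q' t => (q == q') && (t == r)
  | OnPath p q t, OnPath p' q' t' => [&& p == p', q == q' & t.+1 == t']
  | _, _ => false
  end.

Lemma on_walk_next D : on_walk D -> on_walk (next_station D).
Proof.
case: D => [p|q|p q t] /=; rewrite ?eqxx ?leqnn ?orbT//.
case: (p =P q) => [->|_] /=; first by case: ltnP => //= H _; rewrite eqxx.
by case: t => // t /= /andP[/eqP-> /ltnW->]; rewrite eqxx orbT.
Qed.

Lemma station_index_next D : on_walk D ->
  station_index (next_station D) = (station_index D).+1.
Proof.
case: D => [p|q|p q t] /=; rewrite ?eqxx ?(gtn_eqF (ltnSn _))//; try lia.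
case: (p =P q) => [->|ne] /=; first by case: ltnP => /=; rewrite ?eqxx; lia.
case: t => [|t] /= /andP[/eqP pq le_tr]; last by case: eqP; lia.
by rewrite pq mulSn; lia.
Qed.

Lemma linked_next D : on_walk D ->
  linked D (next_station D) || linked (next_station D) D.
Proof.
case: D => [p|q|p q t] /=; rewrite ?eqxx ?orbT//.
case: (p =P q) => [->|ne] /=; first by case: ltnP => /=; rewrite ?eqxx //=; lia.
by case: t => [|t] /=; rewrite ?eqxx ?orbT.
Qed.

(** The walk has no chords: each root is an end of at most two of the paths used, and the walk meets
    these just before and just after the root. *)
Lemma linked_index D E : on_walk D -> on_walk E -> linked D E ->
  station_index D = (station_index E).+1 \/
  station_index E = (station_index D).+1.
Proof.
case: D E => [p|q|p q t] [p'|q'|p' q' t'] //=.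
- move=> _ /andP[/orP[]/eqP-> le_tr] /andP[/eqP-> /eqP->].
    by rewrite eqxx; lia.
  by rewrite (gtn_eqF (ltnSn _)) mulSn; lia.
- move=> _ /andP[/orP[]/eqP-> le_tr] /andP[/eqP-> /eqP->].
    by rewrite eqxx; lia.
  by rewrite (gtn_eqF (ltnSn _)); lia.
- move=> /andP[H le1] /andP[_ le2] /and3P[/eqP<- /eqP<- /eqP<-].
  by case/orP: H => /eqP->; rewrite ?eqxx ?(gtn_eqF (ltnSn _))//; lia.
Qed.

Definition walk (j : nat) : station := iter j next_station (RootA 0).

Lemma walkP j : on_walk (walk j) /\ station_index (walk j) = j.
Proof.
elim: j => // j [walkj idx].
by rewrite /= on_walk_next// station_index_next// idx.
Qed.

Definition blocks_le (R : nat) (D : station) : bool :=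
  match D with
  | RootA p => p <= R
  | RootB q => q <= R
  | OnPath p q _ => (p <= R) && (q <= R)
  end.

(** An index is never smaller than the block numbers of its station. *)
Lemma blocks_le_walk R j : j <= R -> blocks_le R (walk j).
Proof.
move=> leR; have [] := walkP j; case: (walk j) => [p|q|p q t] /=; try nia.
by case/andP => /orP[]/eqP->; rewrite ?eqxx ?(gtn_eqF (ltnSn _))//; nia.
Qed.

End Walk.

Section RootWalk.
Variables (m R n r : nat) (f g : nat -> 'I_m -> 'I_n).
Hypotheses (f_incr : block_increasing R f) (g_incr : block_increasing R g).

Definition place (D : station) (i : 'I_m) : crossing_vertex n r.+1 :=
  match D with
  | RootA p => inl (inl (f p i))
  | RootB q => inl (inr (g q i))
  | OnPath p q t => inr (f p i, g q i, inord t)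
  end.

Lemma place_inj D E i i' : on_walk r D -> on_walk r E ->
  blocks_le R D -> blocks_le R E ->
  place D i = place E i' -> D = E /\ i = i'.
Proof.
case: D E => [p|q|p q t] [p'|q'|p' q' t'] //=.
- move=> _ _ leR leR' [/eqP].
  by rewrite (block_increasing_eq _ _ f_incr)// => /andP[/eqP-> /eqP->].
- move=> _ _ leR leR' [/eqP].
  by rewrite (block_increasing_eq _ _ g_incr)// => /andP[/eqP-> /eqP->].
- move=> /andP[_ let1] /andP[_ let2] /andP[leR1 leR2] /andP[leR3 leR4].
  case=> /eqP E1 /eqP E2 /(congr1 val) /=; rewrite !inordK// => ->.
  move: E1 E2; rewrite (block_increasing_eq _ _ f_incr)//.
  by rewrite (block_increasing_eq _ _ g_incr)// => /andP[/eqP-> /eqP->] /andP[/eqP->].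
Qed.

Definition walk_place (x : 'I_m * 'I_R) : crossing_vertex n r.+1 :=
  place (walk r x.2) x.1.

Lemma walk_place_inj : injective walk_place.
Proof.
move=> [i j] [i' j'] /place_inj.
have [w1 idx1] := walkP r j; have [w2 idx2] := walkP r j'.
case=> //; do ?[by apply: blocks_le_walk; rewrite ltnW].
by move=> E /= ->; congr (_, _); apply: val_inj; rewrite /= -idx1 -idx2 E.
Qed.

Lemma walk_place_uniform k (c : crossing_vertex n r.+1 -> 'I_k) :
  uniform_coloring c f g ->
  forall i i' j, c (walk_place (i, j)) = c (walk_place (i', j)).
Proof.
case=> cA cB cP i i' j; rewrite /walk_place /=.
by case: (walk r j) => [p|q|p q t] /=.
Qed.

(* Whether the relation holds between two distinct blocks may depend on the
   blocks, but not on the elements chosen in them. *)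
Definition blockwise (d : layer_cmp) (ra : rel 'I_n) (h : nat -> 'I_m -> 'I_n) :=
  exists b : rel nat, forall p q i i', p <= R -> q <= R ->
    ra (h p i) (h q i') = if p == q then compare_by d i i' else b p q.

Variables (ra rb : rel 'I_n) (da db : layer_cmp).
Hypotheses (ra_block : blockwise da ra f) (rb_block : blockwise db rb g).

(** Root links carry the relation of their side; along a path, both coordinates compare the same two
    indices and give [=]. *)
Lemma arc_linked D E : on_walk r D -> on_walk r E ->
  blocks_le R D -> blocks_le R E -> linked r D E ->
  exists d, forall i i',
    crossing_arc ra rb (place D i) (place E i') = compare_by d i i'.
Proof.
case: ra_block => ba Ha; case: rb_block => bb Hb.
case: D E => [p|q|p q t] [p'|q'|p' q' t'] //=.
- move=> _ /andP[_ let1] leR /andP[leR1 leR2] /andP[/eqP<- /eqP->].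
  by exists da => i i'; rewrite Ha// eqxx inordK// eqxx andbT.
- move=> _ /andP[_ let1] leR /andP[leR1 leR2] /andP[/eqP<- /eqP->].
  by exists db => i i'; rewrite Hb// eqxx inordK// eqxx andbT.
- move=> /andP[_ let1] /andP[_ let2] /andP[leR1 leR2] _.
  move=> /and3P[/eqP<- /eqP<- /eqP E]; exists CmpEq => i i'.
  rewrite !inordK// E eqxx andbT (block_increasing_eq _ _ f_incr)//.
  by rewrite (block_increasing_eq _ _ g_incr)// !eqxx /= andbb.
Qed.

Lemma arc_unlinked D E : on_walk r D -> on_walk r E ->
  blocks_le R D -> blocks_le R E -> ~~ linked r D E ->
  exists b, forall i i', crossing_arc ra rb (place D i) (place E i') = b.
Proof.
case: ra_block => ba Ha; case: rb_block => bb Hb.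
case: D E => [p|q|p q t] [p'|q'|p' q' t'] //=; do ?by exists false.
- move=> _ /andP[_ let1] leR /andP[leR1 leR2] nl.
  (* If [p == p'], being unlinked means that [t'] is not 0. Only [ba] on distinct blocks survives;
     in a half-graph crossing it can be true. *)
  exists (ba p p' && (t' == 0)) => i i'; rewrite Ha// inordK//.
  by case: eqP nl => //= _ /negbTE->; rewrite !andbF.
- move=> _ /andP[_ let1] leR /andP[leR1 leR2] nl.
  exists (bb q q' && (t' == r)) => i i'; rewrite Hb// inordK// eqSS.
  by case: eqP nl => //= _ /negbTE->; rewrite !andbF.
- move=> /andP[_ let1] /andP[_ let2] /andP[leR1 leR2] /andP[leR3 leR4] nl.
  exists false => i i'; rewrite !inordK// (block_increasing_eq _ _ f_incr)//.
  rewrite (block_increasing_eq _ _ g_incr)//.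
  by apply: contraNF nl => /and3P[/andP[-> _] /andP[-> _] ->].
Qed.

(** Ensures that the edges between consecutive layers follow a single comparison, not its union with
    reversed arcs. *)
Lemma linked_arc_asym D E i i' : on_walk r D -> on_walk r E -> linked r D E ->
  crossing_arc ra rb (place E i) (place D i') = false.
Proof.
case: D E => [p|q|p q t] [p'|q'|p' q' t'] //=.
move=> /andP[_ let1] /andP[_ let2] /and3P[_ _ /eqP E].
by rewrite !inordK// -E (gtn_eqF (leqW (ltnSn t))) !andbF.
Qed.

Lemma walk_pattern :
  is_pattern (pullback walk_place (graph_of (crossing_arc ra rb))).
Proof.
have wR (j : 'I_R) : blocks_le R (walk r j) by apply: blocks_le_walk; rewrite ltnW.
have w (j : 'I_R) : on_walk r (walk r j) by case: (walkP r j).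
have adjE (j j' : 'I_R) i i' : j != j' -> pullback walk_place
      (graph_of (crossing_arc ra rb)) (i, j) (i', j')
    = crossing_arc ra rb (place (walk r j) i) (place (walk r j') i') ||
      crossing_arc ra rb (place (walk r j') i') (place (walk r j) i).
  move=> neq; rewrite /= /pullback_adj /= /graph_of_adj (inj_eq walk_place_inj).
  by rewrite xpair_eqE (negbTE neq) andbF.
apply: is_pattern_ltn => [j|j j' jj'|j j' jj'].
- right=> i i'; rewrite /= /pullback_adj /= /graph_of_adj /walk_place /=.
  case: (walk r j) (w j) => [p|q|p q t] //=; rewrite ?andbF// => /andP[_ let1].
  by rewrite !inordK// gtn_eqF// !andbF.
- have neq : j != j' by rewrite -val_eqE /=; lia.
  have := linked_next (w j); rewrite -[next_station _ _]/(walk r j.+1) jj'.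
  case/orP => lk.
    have [d Hd] := arc_linked (w j) (w j') (wR j) (wR j') lk.
    by exists d => i i'; rewrite adjE// Hd (linked_arc_asym _ _ _ _ lk)// orbF.
  have [d Hd] := arc_linked (w j') (w j) (wR j') (wR j) lk.
  exists (converse_cmp d) => i i'.
  by rewrite adjE// Hd (linked_arc_asym _ _ _ _ lk)// compare_by_converse.
- have neq : j != j' by rewrite -val_eqE /=; lia.
  have [_ idx] := walkP r j; have [_ idx'] := walkP r j'.
  have nl : ~~ linked r (walk r j) (walk r j').
    by apply/negP => /(linked_index (w _) (w _)); rewrite idx idx'; lia.
  have nl' : ~~ linked r (walk r j') (walk r j).
    by apply/negP => /(linked_index (w _) (w _)); rewrite idx idx'; lia.
  have [b Hb] := arc_unlinked (w j) (w j') (wR j) (wR j') nl.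
  have [b' Hb'] := arc_unlinked (w j') (w j) (wR j') (wR j) nl'.
  by case bb: (b || b'); [left | right] => i i'; rewrite adjE// Hb Hb' bb.
Qed.

End RootWalk.

(** * Clique crossings *)

Lemma graph_ofE (V : finType) (e : rel V) u v :
  graph_of e u v = (u != v) && (e u v || e v u).
Proof. by []. Qed.

Section CliqueWalk.
Variable r : nat.

Definition path_point : Type := nat * nat * nat.

(** At the end of a path the walk jumps, inside the clique around the omitted root, to the next path
    at that root: at position [r] going forwards, at 0 going backwards. *)
Definition next_point (D : path_point) : path_point :=
  let: (p, q, t) := D in
  if p == q then (if t < r then (p, q, t.+1) else (p.+1, q, t))
  else (if t is t'.+1 then (p, q, t') else (p, p, t)).

Definition on_clique_walk (D : path_point) : bool :=
  let: (p, q, t) := D in ((p == q) || (p == q.+1)) && (t <= r).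

Definition point_index (D : path_point) : nat :=
  let: (p, q, t) := D in
  q * (2 * r + 2) + (if p == q then t else 2 * r + 1 - t).

Definition point_linked (D E : path_point) : bool :=
  let: (p, q, t) := D in
  let: (p', q', t') := E in
  [|| [&& p == p', q == q' & (t.+1 == t') || (t'.+1 == t)],
      [&& p == p', t == 0 & t' == 0] | [&& q == q', t == r & t' == r]].

Lemma on_clique_walk_next D : on_clique_walk D -> on_clique_walk (next_point D).
Proof.
case: D => [[p q] t] /=; case: (p =P q) => [->|_] /=.
  by case: ltnP => /= [H _|_ H]; rewrite eqxx ?orbT.
by case: t => [|t] /= /andP[/eqP->]; rewrite eqxx ?orbT //= => /ltnW.
Qed.

Lemma point_index_next D : on_clique_walk D ->
  point_index (next_point D) = (point_index D).+1.
Proof.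
case: D => [[p q] t] /=; case: (p =P q) => [->|ne] /=.
  by case: ltnP => /=; rewrite ?eqxx ?(gtn_eqF (ltnSn _)); lia.
case: t => [|t] /= /andP[/eqP pq le_tr]; rewrite ?eqxx.
  by rewrite pq mulSn; lia.
by case: eqP; lia.
Qed.

Lemma point_linked_next D : on_clique_walk D -> point_linked D (next_point D).
Proof.
case: D => [[p q] t] /=; case: (p =P q) => [->|ne] /=.
  case: ltnP => /= [_ _|H le_tr]; first by rewrite !eqxx.
  have -> : t = r by lia.
  by rewrite !eqxx !orbT.
by case: t => [|t] /= _; rewrite !eqxx ?orbT.
Qed.

(** No chords here either: points in the clique of one root are equal or are the two ends between
    which the walk jumps. A one-sided bound suffices because [point_linked] is symmetric. *)
Lemma point_linked_index D E : on_clique_walk D -> on_clique_walk E ->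
  point_linked D E -> point_index D <= (point_index E).+1.
Proof.
case: D E => [[p q] t] [[p' q'] t'] /= /andP[H let1] /andP[H' let2].
case/or3P => /and3P[/eqP E1].
- move=> /eqP E2 E3; subst p' q'.
  by case/orP: H => /eqP->; rewrite ?eqxx ?(gtn_eqF (ltnSn _)); lia.
- move=> /eqP-> /eqP->; subst p'.
  have [|[|]] : q = q' \/ q = q'.+1 \/ q' = q.+1 by lia.
  + by move=> E; move: H H'; rewrite E; do !case: eqP => ?; lia.
  + by move=> E; move: H H'; rewrite E mulSn; do !case: eqP => ?; lia.
  + by move=> E; move: H H'; rewrite E mulSn; do !case: eqP => ?; lia.
- move=> /eqP-> /eqP->; subst q'.
  by case/orP: H => /eqP->; case/orP: H' => /eqP->;
    rewrite ?eqxx ?(gtn_eqF (ltnSn _)); lia.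
Qed.

Definition clique_walk (j : nat) : path_point := iter j next_point (0, 0, 0).

Lemma clique_walkP j :
  on_clique_walk (clique_walk j) /\ point_index (clique_walk j) = j.
Proof.
elim: j => // j [walkj idx].
by rewrite /= on_clique_walk_next// point_index_next// idx.
Qed.

Definition point_blocks_le (R : nat) (D : path_point) : bool :=
  let: (p, q, _) := D in (p <= R) && (q <= R).

Lemma point_blocks_le_walk R j : j <= R -> point_blocks_le R (clique_walk j).
Proof.
move=> leR; have [] := clique_walkP j; case: (clique_walk j) => [[p q] t] /=.
by case/andP => /orP[]/eqP->; rewrite ?eqxx ?(gtn_eqF (ltnSn _)); nia.
Qed.

End CliqueWalk.

Section CliquePlace.
Variables (m R n r : nat) (f g : nat -> 'I_m -> 'I_n).
Hypotheses (f_incr : block_increasing R f) (g_incr : block_increasing R g).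

Definition point_place (D : path_point) (i : 'I_m) : crossing_vertex n r.+1 :=
  let: (p, q, t) := D in inr (f p i, g q i, inord t).

(** Eliminates the quantifier over roots: a shared root must be the common source of two first
    vertices or the common target of two last vertices. *)
Lemma clique_crossing_path (i i' j j' : 'I_n) (t t' : 'I_r.+1) :
  clique_crossing n r.+1 (inr (i, j, t)) (inr (i', j', t')) =
  ((i, j, t) != (i', j', t')) &&
  [|| [&& i == i', j == j' & (t.+1 == t') || (t'.+1 == t)],
      [&& i == i', t == 0 :> nat & t' == 0 :> nat]
    | [&& j == j', t == r :> nat & t' == r :> nat]].
Proof.
have starE (k k' l l' : 'I_n) (s s' : 'I_r.+1) :
    star_crossing n r.+1 (inr (k, l, s)) (inr (k', l', s'))
    = [&& k == k', l == l' & (s.+1 == s' :> nat) || (s'.+1 == s :> nat)].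
  rewrite /= /graph_of_adj /= (eq_sym k' k) (eq_sym l' l) -!andb_orr.
  apply: andb_idl => /and3P[_ _]; apply: contraTneq => -[_ _ ->].
  by rewrite orbb gtn_eqF.
have rootE : forall (k k' l l' : 'I_n) (s s' : 'I_r.+1),
    [exists x, star_crossing n r.+1 (inl x) (inr (k, l, s)) &&
               star_crossing n r.+1 (inl x) (inr (k', l', s'))]
    = [&& k == k', s == 0 :> nat & s' == 0 :> nat]
      || [&& l == l', s == r :> nat & s' == r :> nat].
  move=> k k' l l' s s'; apply/existsP/orP.
    case=> -[x|x]; rewrite /= /graph_of_adj /= !orbF ?eqSS.
      by case/andP => /andP[/eqP<- ->] /andP[/eqP<- ->]; left; rewrite eqxx.
    by case/andP => /andP[/eqP<- ->] /andP[/eqP<- ->]; right; rewrite eqxx.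
  case=> /and3P[/eqP<- s0 s0'].
    by exists (inl k); rewrite /= /graph_of_adj /= !orbF eqxx s0 s0'.
  by exists (inr l); rewrite /= /graph_of_adj /= !orbF !eqSS eqxx s0 s0'.
rewrite /clique_crossing graph_ofE; congr (_ && _).
rewrite !starE !rootE (eq_sym i' i) (eq_sym j' j) (orbC (t'.+1 == t)).
rewrite (andbC (t' == 0 :> nat)) (andbC (t' == r :> nat)).
by rewrite orbb.
Qed.

(** Sharing a source or a target already forces [i == i'], because walk [i] uses [i]th elements on
    both sides; so clique edges, too, only give the relation [=]. *)
Lemma point_place_adj D E i i' : on_clique_walk r D -> on_clique_walk r E ->
  point_blocks_le R D -> point_blocks_le R E ->
  clique_crossing n r.+1 (point_place D i) (point_place E i') =
  [&& D != E, i == i' & point_linked r D E].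
Proof.
case: D E => [[p q] t] [[p' q'] t'] /andP[_ let1] /andP[_ let2].
move=> /andP[leR1 leR2] /andP[leR3 leR4].
rewrite /point_place clique_crossing_path !inordK// !xpair_eqE.
rewrite (block_increasing_eq _ _ f_incr)// (block_increasing_eq _ _ g_incr)//.
have -> : (inord t == inord t' :> 'I_r.+1) = (t == t').
  by rewrite -val_eqE /= !inordK.
by case: (i == i'); rewrite /= ?andbT // !andbF.
Qed.

Definition clique_walk_place (x : 'I_m * 'I_R) : crossing_vertex n r.+1 :=
  point_place (clique_walk r x.2) x.1.

Lemma clique_walk_place_inj : injective clique_walk_place.
Proof.
move=> [i j] [i' j']; rewrite /clique_walk_place /=.
have [w1 idx1] := clique_walkP r j; have [w2 idx2] := clique_walkP r j'.
have := @point_blocks_le_walk r R _ (ltnW (ltn_ord j)).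
have := @point_blocks_le_walk r R _ (ltnW (ltn_ord j')).
case E1: (clique_walk r j) w1 idx1 => [[p q] t] w1 idx1.
case E2: (clique_walk r j') w2 idx2 => [[p' q'] t'] w2 idx2 /=.
move: w1 w2 => /andP[_ let1] /andP[_ let2].
move=> /andP[leR1 leR2] /andP[leR3 leR4].
case=> /eqP + /eqP + /(congr1 val) /=; rewrite !inordK//.
rewrite (block_increasing_eq _ _ f_incr)// (block_increasing_eq _ _ g_incr)//.
move=> /andP[/eqP pp' /eqP->] /andP[/eqP qq' _] tt'.
by congr (_, _); apply: val_inj; rewrite /= -idx1 -idx2 pp' qq' tt'.
Qed.

Lemma clique_walk_place_uniform k (c : crossing_vertex n r.+1 -> 'I_k) :
  uniform_coloring c f g ->
  forall i i' j, c (clique_walk_place (i, j)) = c (clique_walk_place (i', j)).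
Proof.
case=> _ _ cP i i' j; rewrite /clique_walk_place /=.
by case: (clique_walk r j) => [[p q] t] /=.
Qed.

Lemma clique_walk_pattern :
  is_pattern (pullback clique_walk_place (clique_crossing n r.+1)).
Proof.
have wR (j : 'I_R) : point_blocks_le R (clique_walk r j).
  by apply: point_blocks_le_walk; rewrite ltnW.
have w (j : 'I_R) : on_clique_walk r (clique_walk r j).
  by case: (clique_walkP r j).
have adjE (j j' : 'I_R) i i' :
    pullback clique_walk_place (clique_crossing n r.+1) (i, j) (i', j')
    = [&& j != j', i == i' & point_linked r (clique_walk r j) (clique_walk r j')].
  rewrite [LHS]point_place_adj//; congr (~~ _ && _).
  apply/eqP/eqP => [E|->//]; apply: val_inj => /=.
  by have [_ <-] := clique_walkP r j; have [_ <-] := clique_walkP r j'; rewrite E.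
apply: is_pattern_ltn => [j|j j' jj'|j j' jj'].
- by right=> i i'; rewrite adjE eqxx.
- exists CmpEq => i i'; rewrite adjE -jj' /= point_linked_next// andbT.
  by rewrite -val_eqE /= -jj' ltn_eqF.
- right=> i i'; rewrite adjE; apply/negP => /and3P[_ _ lk].
  have [_ idx] := clique_walkP r j; have [_ idx'] := clique_walkP r j'.
  (* The one-sided index bound is wanted with the later point first, so the link is reversed. *)
  have lk' : point_linked r (clique_walk r j') (clique_walk r j).
    move: lk; case: (clique_walk r j) (clique_walk r j') => [[p q] t] [[p' q'] t'].
    by rewrite /= (eq_sym p) (eq_sym q) (orbC (t.+1 == _))
      (andbC (t == 0)) (andbC (t == r)).
  have := point_linked_index (w _) (w _) lk'.
  by rewrite idx idx'; lia.
Qed.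

End CliquePlace.

(** * Comparability grids *)

Section GridWalk.
Variables (m R : nat).

(** Layer [j] is the diagonal of the block whose coordinates are [j] halved, rounded down and up;
    this is the staircase. *)
Definition grid_walk (x : 'I_m * 'I_R) : 'I_(R.+1 * m).+1 * 'I_(R.+1 * m).+1 :=
  (inord (x.2./2 * m + x.1), inord (uphalf x.2 * m + x.1)).

Lemma grid_walk_val x :
  (grid_walk x).1 = x.2./2 * m + x.1 :> nat /\
  (grid_walk x).2 = uphalf x.2 * m + x.1 :> nat.
Proof.
case: x => i j /=; have lti := ltn_ord i; have ltj := ltn_ord j.
have le1 : j./2 <= R by lia.
have le2 : uphalf j <= R by lia.
by rewrite !inordK// block_bound.
Qed.

Lemma grid_adj N (u v : 'I_N * 'I_N) : comparability_grid N u v =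
  (u != v) && [|| u.1 == v.1, u.2 == v.2 | (u.1 < v.1) == (u.2 < v.2)].
Proof.
rewrite /= /graph_of_adj; case: eqVneq => //= _.
rewrite (eq_sym v.1) (eq_sym v.2); case: eqVneq => //= n1; case: eqVneq => //= n2.
move: n1 n2; rewrite -!val_eqE /=; lia.
Qed.

Lemma grid_walk_inj : injective grid_walk.
Proof.
move=> x y E; have [vx1 vx2] := grid_walk_val x; have [vy1 vy2] := grid_walk_val y.
rewrite E in vx1 vx2; have {vx1} /eqP := etrans (esym vx1) vy1.
have {vx2} /eqP := etrans (esym vx2) vy2; rewrite !eqn_block.
case: x y {E vy1 vy2} => [i j] [i' j'] /= /andP[/eqP e1 _] /andP[/eqP e2 /eqP ->].
by congr (_, _); apply: val_inj => /=; lia.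
Qed.

Lemma grid_walk_pattern :
  is_pattern (pullback grid_walk (comparability_grid (R.+1 * m).+1)).
Proof.
have adjE x y : pullback grid_walk (comparability_grid (R.+1 * m).+1) x y =
    (x != y) && [|| (grid_walk x).1 == (grid_walk y).1 :> nat,
      (grid_walk x).2 == (grid_walk y).2 :> nat
    | ((grid_walk x).1 < (grid_walk y).1) == ((grid_walk x).2 < (grid_walk y).2)].
  by rewrite -(inj_eq grid_walk_inj); apply: grid_adj.
have valE x : ((grid_walk x).1 = x.2./2 * m + x.1 :> nat) *
    ((grid_walk x).2 = uphalf x.2 * m + x.1 :> nat).
  by have [] := grid_walk_val x.
apply: is_pattern_ltn => [j|j j' jj'|j j' jj'].
- left=> i i' ne; rewrite adjE !valE /= !ltn_add2l eqxx !orbT andbT.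
  by rewrite xpair_eqE eqxx andbT.
(* Consecutive layers share the block of one coordinate and advance in the other, where the earlier
   layer is always smaller; adjacency thus means [i = i'] or [i < i']. *)
- exists CmpLe => i i'; rewrite adjE !valE !eqn_block !ltn_block_if -jj' xpair_eqE.
  have -> : (j == j') = false by rewrite -val_eqE /= -jj' ltn_eqF.
  rewrite andbF -val_eqE /= leq_eqVlt.
  by do !case: eqP; lia.
(* Two or more layers apart, both coordinates lie in later blocks, hence full adjacency. *)
- left=> i i'; rewrite adjE !valE /= !ltn_block_if xpair_eqE.
  have -> : (j == j') = false by rewrite -val_eqE /= ltn_eqF// ltnW.
  rewrite andbF /=; do !case: eqP; lia.
Qed.

End GridWalk.

Theorem theorem4p1 (C : graph_class) :
  pattern_free C -> monadically_dependent C.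
Proof.
(* As paths have at least one vertex, their length is written [r.+1], and positions run from 0 to
   the new [r]. *)
case=> m [R free] [[|r] [k [//= _ indep]]].
have eq_block n (h : nat -> 'I_m -> 'I_n) :
    block_increasing R h -> blockwise R CmpEq eq_op h.
  move=> incr; exists (fun _ _ => false) => p q i i' leR leR'.
  by rewrite (block_increasing_eq _ _ incr)//; case: (p == q).
have le_block n (h : nat -> 'I_m -> 'I_n) : block_increasing R h ->
    blockwise R CmpLe (fun i i' : 'I_n => i <= i') h.
  move=> incr; exists ltn => p q i i' leR leR'.
  by rewrite (block_increasing_leq _ _ incr).
case: indep => [star|clique|half|grid].
- apply: crossing_flip_not_contained free _ star => n f g fi gi.
  exists (@walk_place m R n r f g); split; last exact: walk_place_uniform.
    exact: walk_place_inj.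
  by apply: walk_pattern; eauto.
- apply: crossing_flip_not_contained free _ clique => n f g fi gi.
  exists (@clique_walk_place m R n r f g); split; last exact: clique_walk_place_uniform.
    exact: clique_walk_place_inj.
  exact: clique_walk_pattern.
- apply: crossing_flip_not_contained free _ half => n f g fi gi.
  exists (@walk_place m R n r f g); split; last exact: walk_place_uniform.
    exact: walk_place_inj.
  by apply: walk_pattern; eauto.
- exact: pattern_free_embedding free (grid _) (@grid_walk_inj m R)
    (grid_walk_pattern m R).
Qed.
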